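(* Let $N\ge1$ be an integer, $\mathcal X=\{0,1,\dots,N\}$, $a,b,c>0$, and let $$K(x,y)=\sum_{z=\max(0,x+y-N)}^{\min(x,y)}\pi(x-z,N-y,b,c)\,\pi(z,y,a,b)\qquad(x,y\in\mathcal X),$$ where $\pi$ is the Hahn measure. Then $K(x,y)\ge0$, $\sum_{x\in\mathcal X}K(x,y)=1$, and with $\lambda=(a+b,b+c)$ one has, for all $x,y,n\in\mathcal X$, $$K(x,y)\,\pi(y,N,\lambda)=K(y,x)\,\pi(x,N,\lambda),$$ $$\sum_{y\in\mathcal X}K(x,y)\,\pi(y,N,\lambda)\,\check P_n(y,\lambda)=\kappa(n)\,\pi(x,N,\lambda)\,\check P_n(x,\lambda),$$ with $$\kappa(n)=\sum_{k=0}^n\binom nk(-1)^k\frac{(b)_k(n+a+2b+c-1)_k}{(a+b)_k(b+c)_k}.$$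
   Context: $(a)_n=a(a+1)\cdots(a+n-1)$. Hahn measure ($a,b>0$, integers $0\le x\le M$): $\pi(x,M,a,b)=\binom Mx\frac{(a)_x(b)_{M-x}}{(a+b)_M}$. Hahn polynomials on $\mathcal X$: $\check P_n(x,a,b)=\sum_{k=0}^n\frac{(-n)_k(n+a+b-1)_k(-x)_k}{(a)_k(-N)_k\,k!}$. *)

(* Defs.v *)
From HB Require Import structures.
From mathcomp Require Import all_boot all_order all_algebra.

Set Implicit Arguments.
Unset Strict Implicit.
Unset Printing Implicit Defensive.

Import Order.TTheory GRing.Theory Num.Theory.
Local Open Scope ring_scope.

(* Rising factorial a (a + 1) ... (a + n - 1). *)
Definition poch (R : realFieldType) (a : R) (n : nat) : R :=
  \prod_(i < n) (a + i%:R).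

(* Only meant for x <= M: the subtraction M - x is the truncated one on nat. *)
Definition hahn_measure (R : realFieldType) (x M : nat) (a b : R) : R :=
  'C(M, x)%:R * (poch a x * poch b (M - x)) / poch (a + b) M.

(* Only meant for n <= N, so that poch (- N%:R) k != 0 for all k <= n. *)
Definition hahn_poly (R : realFieldType) (N n x : nat) (a b : R) : R :=
  \sum_(k < n.+1)
    (poch (- n%:R) k * poch (n%:R + a + b - 1) k * poch (- x%:R) k)
    / (poch a k * poch (- N%:R) k * k`!%:R).

(* For x, y <= N. The truncated subtraction x + y - N is max(0, x + y - N). *)
Definition hahn_kernel (R : realFieldType) (N : nat) (a b c : R)
    (x y : nat) : R :=
  \sum_(x + y - N <= z < (minn x y).+1)
    hahn_measure (x - z) (N - y) b c * hahn_measure z y a b.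

Definition hahn_kappa (R : realFieldType) (a b c : R) (n : nat) : R :=
  \sum_(k < n.+1)
    'C(n, k)%:R * (-1) ^+ k
    * (poch b k * poch (n%:R + a + 2 * b + c - 1) k)
    / (poch (a + b) k * poch (b + c) k).

(* Main.v *)
Require Import Defs.
From mathcomp Require Import all_boot all_order all_algebra.
From mathcomp Require Import ring zify.

Import Order.TTheory GRing.Theory Num.Theory.
Local Open Scope ring_scope.

(* The kernel draws z from pi(., y, a, b) and w from pi(., N - y, b, c) and moves
   y to x = z + w; the joint law of (z, y - z, w, N - y - w) is the
   Dirichlet-multinomial law with parameters (a, b, b, c), whose symmetry in
   the two middle cells gives detailed balance.  By Vandermonde's identity
   K^T maps polynomials of degree at most d to polynomials of degree at most d,
   and it is self-adjoint for pi(., N, lambda), so the n-th orthogonal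
   polynomial is an eigenvector of K^T.  Its eigenvalue is read off at y = 0,
   where P_n = 1 and K(., 0) is the Hahn measure pi(., N, b, c). *)

(** * Rising factorials *)

Lemma poch0 {R : realFieldType} (a : R) : poch a 0 = 1.
Proof. by rewrite /poch big_ord0. Qed.

Lemma pochS {R : realFieldType} (a : R) n : poch a n.+1 = poch a n * (a + n%:R).
Proof. by rewrite /poch big_ord_recr. Qed.

Lemma pochD {R : realFieldType} (a : R) m n :
  poch a (m + n) = poch a m * poch (a + m%:R) n.
Proof.
elim: n => [|n IHn]; first by rewrite addn0 poch0 mulr1.
by rewrite addnS !pochS IHn natrD mulrA addrA.
Qed.

Lemma pochSl {R : realFieldType} (a : R) n : poch a n.+1 = a * poch (a + 1) n.
Proof. by rewrite -add1n pochD pochS poch0 mul1r addr0. Qed.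

Lemma poch_gt0 {R : realFieldType} (a : R) n : 0 < a -> 0 < poch a n.
Proof. by move=> a0; apply: prodr_gt0 => i _; rewrite ltr_wpDr. Qed.

Lemma poch_neq0 {R : realFieldType} (a : R) n : 0 < a -> poch a n != 0.
Proof. by move=> a0; rewrite gt_eqF ?poch_gt0. Qed.

Lemma poch_opp_nat {R : realFieldType} n k :
  poch (- n%:R : R) k = (-1) ^+ k * k`!%:R * 'C(n, k)%:R.
Proof.
rewrite -mulrA -natrM mulnC bin_ffact.
elim: k => [|k IHk]; first by rewrite poch0 mul1r.
rewrite pochS IHk exprS ffactnSr natrM.
have [lekn|ltnk] := leqP k n; first by rewrite natrB //; ring.
by rewrite ffact_small // !(mul0r, mulr0).
Qed.

Lemma poch_opp_nat_eq0 {R : realFieldType} n k :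
  (n < k)%N -> poch (- n%:R : R) k = 0.
Proof. by move=> ltnk; rewrite poch_opp_nat bin_small // mulr0. Qed.

(** * Vandermonde summations, by induction through Pascal's rule *)

Lemma sum_binS {R : realFieldType} n (f : nat -> R) :
  \sum_(k < n.+2) 'C(n.+1, k)%:R * f k
  = \sum_(k < n.+1) 'C(n, k)%:R * (f k + f k.+1).
Proof.
rewrite big_ord_recl /= bin0 mul1r.
under eq_bigr => i _ do rewrite /bump add1n binS natrD mulrDl.
under [RHS]eq_bigr => i _ do rewrite mulrDr.
rewrite !big_split /= addrA; congr (_ + _).
rewrite big_ord_recr /= bin_small // mul0r addr0.
by rewrite [RHS]big_ord_recl bin0 mul1r.
Qed.

Lemma poch_vandermonde {R : realFieldType} (a b : R) n :
  \sum_(k < n.+1) 'C(n, k)%:R * (poch a k * poch b (n - k)) = poch (a + b) n.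
Proof.
elim: n => [|n IHn]; first by rewrite big_ord1 !poch0 !mulr1.
rewrite (sum_binS n (fun k => poch a k * poch b (n.+1 - k))) pochS -IHn mulr_suml.
apply: eq_bigr => -[k /= ltkn] _.
by rewrite subSn // subSS !pochS natrB //; ring.
Qed.

(** Pascal's rule splits the sum into the case [n] at [(u, v)] and at [(u + 1, v + 1)]; the
    difference [v - u] is the same in both, so the induction runs over all [u] and [v]. *)
Lemma chu_vandermonde {R : realFieldType} (u v : R) n : 0 < v ->
  \sum_(k < n.+1) 'C(n, k)%:R * ((-1) ^+ k * poch u k / poch v k)
  = poch (v - u) n / poch v n.
Proof.
elim: n u v => [|n IHn] u v v0; first by rewrite big_ord1 !poch0 expr0 !mul1r.
rewrite (sum_binS n (fun k => (-1) ^+ k * poch u k / poch v k)).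
under eq_bigr => k _ do rewrite mulrDr.
rewrite big_split /= IHn //.
have -> : \sum_(i < n.+1) 'C(n, i)%:R * ((-1) ^+ i.+1 * poch u i.+1 / poch v i.+1)
   = - (u / v) * (poch (v - u) n / poch (v + 1) n).
  have -> : v - u = v + 1 - (u + 1) by ring.
  rewrite -IHn ?addr_gt0 // mulr_sumr.
  apply: eq_bigr => i _; rewrite !pochSl exprS.
  by field; rewrite !poch_neq0 ?gt_eqF ?addr_gt0.
have := pochSl v n; rewrite !pochS => E.
have vn : v + n%:R != 0 by rewrite gt_eqF // ltr_wpDr.
have -> : poch (v + 1) n = poch v n * (v + n%:R) / v.
  by rewrite E mulrC mulKf // gt_eqF.
by field; rewrite poch_neq0 ?vn ?gt_eqF.
Qed.

(** * Binomial moments of the Hahn measure *)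

(** Multiplied by [k! x! (m - x)!], both sides become [(k + m)!]. *)
Lemma bin_shift k m x : (x <= m)%N ->
  ('C(k + m, k + x) * 'C(k + x, k) = 'C(k + m, k) * 'C(m, x))%N.
Proof.
move=> lexm; apply/eqP.
rewrite -(eqn_pmul2r (_ : 0 < k`! * (x`! * (m - x)`!))%N) ?muln_gt0 ?fact_gt0 //.
have h1 := @bin_fact (k + m) (k + x); have h2 := @bin_fact (k + x) k.
have h3 := @bin_fact (k + m) k; have h4 := @bin_fact m x.
rewrite subnDl leq_add2l in h1; rewrite addKn leq_addr in h2.
rewrite addKn leq_addr in h3.
apply/eqP; transitivity (k + m)`!.
  by rewrite -(h1 lexm) -(h2 isT); ring.
by rewrite -(h3 isT) -(h4 lexm); ring.
Qed.

Lemma hahn_measure_gt0 {R : realFieldType} x M (a b : R) :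
  (x <= M)%N -> 0 < a -> 0 < b -> 0 < hahn_measure x M a b.
Proof.
move=> lexM a0 b0.
by rewrite /hahn_measure divr_gt0 ?mulr_gt0 ?poch_gt0 ?addr_gt0 // ltr0n bin_gt0.
Qed.

(** The factor ['C(x, k)] kills the terms with [x < k]; after the shift of [x] by [k] the rest is a
    Vandermonde sum with parameters [a + k] and [b]. *)
Lemma hahn_measure_bin_moment {R : realFieldType} M k (a b : R) : 0 < a -> 0 < b ->
  \sum_(x < M.+1) hahn_measure x M a b * 'C(x, k)%:R
  = 'C(M, k)%:R * poch a k / poch (a + b) k.
Proof.
move=> a0 b0; have [lekM|ltMk] := leqP k M; last first.
  rewrite bin_small // !mul0r big1 // => -[x /= lexM] _.
  by rewrite bin_small ?mulr0 //; lia.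
have [m ->] : exists m, M = (k + m)%N by exists (M - k)%N; lia.
rewrite -(big_mkord xpredT (fun x => hahn_measure x (k + m) a b * 'C(x, k)%:R)).
rewrite (big_cat_nat (n := k)) //=; last by lia.
rewrite big_nat_cond big1 ?add0r; last first.
  by move=> x; rewrite andbT => /andP[_ ltxk]; rewrite bin_small ?mulr0.
rewrite -{1}(add0n k) big_addn -addnS addKn big_mkord.
have -> : 'C(k + m, k)%:R * poch a k / poch (a + b) k
    = 'C(k + m, k)%:R * poch a k / poch (a + b) (k + m) * poch (a + k%:R + b) m.
  rewrite pochD (addrAC a); field.
  have ab0 := addr_gt0 a0 b0.
  by rewrite !poch_neq0 // addrAC ltr_wpDr.
rewrite -(poch_vandermonde (a + k%:R) b m) mulr_sumr.
apply: eq_bigr => -[x /= ltxm] _; rewrite /hahn_measure.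
have -> : (k + m - (x + k) = m - x)%N by lia.
rewrite (addnC x) pochD.
have := congr1 (fun i : nat => i%:R : R) (bin_shift k m x ltxm); rewrite !natrM => E.
transitivity ('C(k + m, k + x)%:R * 'C(k + x, k)%:R * (poch a k
   * poch (a + k%:R) x * poch b (m - x)) / poch (a + b) (k + m)); first by ring.
by rewrite E; ring.
Qed.

Lemma sum_hahn_measure {R : realFieldType} M (a b : R) : 0 < a -> 0 < b ->
  \sum_(x < M.+1) hahn_measure x M a b = 1.
Proof.
move=> a0 b0; have := hahn_measure_bin_moment M 0 a b a0 b0.
rewrite bin0 !poch0 divr1 mulr1 mulr1n => <-.
by apply: eq_bigr => x _; rewrite bin0 mulr1.
Qed.

(** * The kernel as a law of a sum, and detailed balance *)

(** The bounds on [z] in the kernel say exactly that [w = x - z] is a natural number at most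
    [N - y]. In this form a sum over [x] can be exchanged with those over [z] and [w]. *)
Lemma hahn_kernelE {R : realFieldType} N (a b c : R) x y : (y <= N)%N ->
  hahn_kernel N a b c x y
  = \sum_(z < y.+1) \sum_(w < (N - y).+1 | (z + w == x)%N)
      hahn_measure w (N - y) b c * hahn_measure z y a b.
Proof.
move=> leyN; rewrite /hahn_kernel.
rewrite -(big_mkord xpredT (fun z => \sum_(w < (N - y).+1 | (z + w == x)%N)
  hahn_measure w (N - y) b c * hahn_measure z y a b)).
rewrite [RHS](bigID (fun z => (x + y - N <= z < (minn x y).+1)%N)) /=.
rewrite [X in _ + X]big1_seq ?addr0; last first.
  move=> z /andP[hz]; rewrite mem_index_iota => hzy.
  by rewrite big1 // => -[w /= hw] /eqP ?; exfalso; lia.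
rewrite [LHS](big_nat_widen _ _ y.+1); last by lia.
rewrite [LHS](big_nat_widenl _ 0) //.
apply: congr_big_nat => // z hz; first by lia.
move: hz => /andP[hz _].
have hw : (x - z < (N - y).+1)%N by lia.
rewrite (big_pred1 (Ordinal hw)) // => -[w hw'] /=.
by rewrite -val_eqE /=; lia.
Qed.

Lemma sum_hahn_kernel {R : realFieldType} N (a b c : R) y (f : nat -> R) :
  (y <= N)%N ->
  \sum_(x < N.+1) hahn_kernel N a b c x y * f x
  = \sum_(z < y.+1) \sum_(w < (N - y).+1)
      hahn_measure w (N - y) b c * hahn_measure z y a b * f (z + w)%N.
Proof.
move=> leyN.
under eq_bigr => x _ do rewrite hahn_kernelE // mulr_suml.
rewrite exchange_big; apply: eq_bigr => -[z /= hz] _.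
under eq_bigr => x _ do rewrite mulr_suml big_mkcond.
rewrite exchange_big; apply: eq_bigr => -[w /= hw] _.
have hx : (z + w < N.+1)%N by lia.
by rewrite -big_mkcond (big_pred1 (Ordinal hx)).
Qed.

Lemma hahn_kernel_ge0 {R : realFieldType} N (a b c : R) x y :
  0 < a -> 0 < b -> 0 < c -> (y <= N)%N -> 0 <= hahn_kernel N a b c x y.
Proof.
move=> a0 b0 c0 leyN; rewrite hahn_kernelE //.
apply: sumr_ge0 => -[z hz] _; apply: sumr_ge0 => -[w hw] _ /=.
by rewrite ltW // mulr_gt0 ?hahn_measure_gt0.
Qed.

Lemma sum_hahn_kernel1 {R : realFieldType} N (a b c : R) y :
  0 < a -> 0 < b -> 0 < c -> (y <= N)%N ->
  \sum_(x < N.+1) hahn_kernel N a b c x y = 1.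
Proof.
move=> a0 b0 c0 leyN.
under eq_bigr => x _ do rewrite -[hahn_kernel _ _ _ _ _ _]mulr1.
rewrite (sum_hahn_kernel N a b c y (fun=> 1)) //.
rewrite -[RHS](sum_hahn_measure y a b a0 b0); apply: eq_bigr => z _.
under eq_bigr => w _ do rewrite mulr1.
by rewrite -mulr_suml sum_hahn_measure // mul1r.
Qed.

(** The identity holds term by term in [z]: exchanging [x] and [y] swaps the cells [x - z] and
    [y - z], which both carry the parameter [b]. *)
Lemma hahn_kernel_balance {R : realFieldType} N (a b c : R) x y :
  0 < a -> 0 < b -> 0 < c -> (x <= N)%N -> (y <= N)%N ->
  hahn_kernel N a b c x y * hahn_measure y N (a + b) (b + c)
  = hahn_kernel N a b c y x * hahn_measure x N (a + b) (b + c).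
Proof.
move=> a0 b0 c0 lexN leyN.
rewrite /hahn_kernel (addnC y) (minnC y) !mulr_suml.
apply: eq_big_nat => z hz; rewrite /hahn_measure.
have -> : (N - x - (y - z) = N - y - (x - z))%N by lia.
(* Both products are the multinomial coefficient of [N] over the cells [z], [y - z], [x - z] and
   [N - y - (x - z)]. *)
have E : (('C(N, y) * 'C(y, z) * 'C(N - y, x - z))%N
   = ('C(N, x) * 'C(x, z) * 'C(N - x, y - z))%N :> nat).
  have lezy : (z <= y)%N by lia.
  have lezx : (z <= x)%N by lia.
  have hy : (x - z <= N - y)%N by lia.
  have hx : (y - z <= N - x)%N by lia.
  have f0 := fact_gt0.
  apply/eqP; rewrite -(eqn_pmul2r (_ :
    0 < z`! * (y - z)`! * ((x - z)`! * (N - y - (x - z))`!))%N) ?muln_gt0 ?f0 //.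
  apply/eqP; transitivity N`!.
    rewrite -(bin_fact leyN) -(bin_fact lezy) -(bin_fact hy).
    by ring.
  rewrite -(bin_fact lexN) -(bin_fact lezx) -(bin_fact hx).
  have -> : (N - x - (y - z) = N - y - (x - z))%N by lia.
  by ring.
move/(congr1 (fun i : nat => i%:R : R)): E; rewrite !natrM => E.
set C1 := 'C(N, y)%:R in E *; set C2 := 'C(y, z)%:R in E *.
set C3 := 'C(N - y, _)%:R in E *; set C4 := 'C(N, x)%:R in E *.
set C5 := 'C(x, z)%:R in E *; set C6 := 'C(N - x, _)%:R in E *.
set p := poch a z; set q := poch b _; set r := poch b _; set s := poch c _.
(* The denominators [(a + b)_y] and [(b + c)_(N - y)] from the kernel cancel against the numerator
   of the stationary measure. *)
transitivity (C1 * C2 * C3 * (p * q * r * s) / poch (a + b + (b + c)) N).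
  by field; rewrite !poch_neq0 ?addr_gt0.
rewrite E.
by field; rewrite !poch_neq0 ?addr_gt0.
Qed.

(** * Action of the kernel on polynomials *)

(** One polynomial in each degree below [n] spans all polynomials of size at most [n]: a multiple of
    the last one removes the top coefficient. *)
Lemma poly_graded_ind {R : realFieldType} (P : {poly R} -> Prop)
    (q : nat -> {poly R}) n :
    (forall m, (m < n)%N -> size (q m) = m.+1) -> P 0 ->
    (forall p m c, (m < n)%N -> P p -> P (p + c *: q m)) ->
  forall p : {poly R}, (size p <= n)%N -> P p.
Proof.
move=> + P0; elim: n => [|n IHn] sq PD p sp.
  by move: sp; rewrite leqn0 size_poly_eq0 => /eqP ->.
have qn : size (q n) = n.+1 by apply: sq.
have lc : (q n)`_n != 0.
  by have := lead_coef_eq0 (q n); rewrite /lead_coef qn -size_poly_eq0 qn /= => ->.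
rewrite -(subrK (p`_n / (q n)`_n *: q n) p); apply: (PD) => //.
apply: IHn => [m hm|p' m c hm|].
- by apply: sq; lia.
- by apply: PD; lia.
apply/leq_sizeP => j; rewrite leq_eqVlt coefB coefZ => /orP[/eqP <-|hj].
  by rewrite divfK ?subrr.
rewrite [p`_j]nth_default ?(leq_trans sp) //.
by rewrite [(q n)`_j]nth_default ?qn ?mulr0 ?subr0.
Qed.

(** The polynomial [X] choose [k]; in this basis the Hahn moments have a product form. *)
Definition binom_poly (R : realFieldType) k : {poly R} :=
  k`!%:R^-1 *: \prod_(i < k) ('X - i%:R%:P).

Lemma size_binom_poly {R : realFieldType} k : size (binom_poly R k) = k.+1.
Proof.
rewrite size_scale ?invr_eq0 ?pnatr_eq0 -?lt0n ?fact_gt0 //.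
by rewrite -(big_mkord xpredT (fun i => 'X - i%:R%:P)) size_prod_XsubC size_iota subn0.
Qed.

Lemma horner_binom_poly {R : realFieldType} k x :
  (binom_poly R k).[x%:R] = 'C(x, k)%:R.
Proof.
rewrite hornerZ horner_prod.
apply: (canLR (mulKf _)); first by rewrite pnatr_eq0 -lt0n fact_gt0.
rewrite -natrM mulnC bin_ffact.
elim: k => [|k IHk]; first by rewrite big_ord0.
rewrite big_ord_recr /= IHk hornerXsubC ffactnSr natrM.
have [lekx|ltxk] := leqP k x; first by rewrite natrB.
by rewrite ffact_small // !mul0r.
Qed.

(** Vandermonde's identity splits ['C(z + w, k)] into products ['C(z, j) * 'C(w, k - j)], and the
    double sum factors into two Hahn moments. *)
Lemma hahn_kernel_bin {R : realFieldType} N (a b c : R) y k :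
  0 < a -> 0 < b -> 0 < c -> (y <= N)%N ->
  \sum_(x < N.+1) hahn_kernel N a b c x y * 'C(x, k)%:R
  = \sum_(j < k.+1) (poch a j / poch (a + b) j * (poch b (k - j) / poch (b + c) (k - j)))
      * ('C(y, j)%:R * 'C(N - y, k - j)%:R).
Proof.
move=> a0 b0 c0 leyN; rewrite (sum_hahn_kernel N a b c y (fun x => 'C(x, k)%:R)) //=.
transitivity (\sum_(j < k.+1) (\sum_(z < y.+1) hahn_measure z y a b * 'C(z, j)%:R)
   * (\sum_(w < (N - y).+1) hahn_measure w (N - y) b c * 'C(w, k - j)%:R)).
  under [RHS]eq_bigr => j _ do rewrite mulr_suml.
  rewrite [RHS]exchange_big; apply: eq_bigr => z _ /=.
  under [RHS]eq_bigr => j _ do rewrite mulr_sumr.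
  rewrite [RHS]exchange_big; apply: eq_bigr => w _ /=.
  rewrite -(binomial.Vandermonde z w k) natr_sum mulr_sumr; apply: eq_bigr => j _.
  by rewrite natrM; ring.
apply: eq_bigr => j _; rewrite !hahn_measure_bin_moment //.
by ring.
Qed.

Lemma hahn_kernel_poly {R : realFieldType} N (a b c : R) n (p : {poly R}) :
  0 < a -> 0 < b -> 0 < c -> (size p <= n)%N ->
  exists2 q : {poly R}, (size q <= n)%N &
    forall y, (y <= N)%N ->
      \sum_(x < N.+1) hahn_kernel N a b c x y * p.[x%:R] = q.[y%:R].
Proof.
move=> a0 b0 c0.
move: p; apply: (@poly_graded_ind _ _ (binom_poly R) n) => [m _||p m d ltmn [q sq qE]].
- exact: size_binom_poly.
- exists 0; rewrite ?size_poly0 // => y _.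
  by rewrite big1 ?horner0 // => x _; rewrite horner0 mulr0.
pose r j := poch a j / poch (a + b) j * (poch b (m - j) / poch (b + c) (m - j)).
(* The right-hand side of [hahn_kernel_bin] as a polynomial in [y]: composing with [N - X] gives
   ['C(N - y, m - j)], so each product has degree [j + (m - j) = m]. *)
pose s := \sum_(j < m.+1) r j *:
  (binom_poly R j * (binom_poly R (m - j) \Po (N%:R%:P - 'X))).
exists (q + d *: s).
  apply: leq_trans (size_polyD _ _) _; rewrite geq_max sq /=.
  apply: leq_trans (size_scale_leq _ _) _.
  apply: leq_trans (size_sum _ _ _) _; apply/bigmax_leqP => -[j /= hj] _.
  apply: leq_trans (size_scale_leq _ _) _.
  apply: leq_trans (size_polyMleq _ _) _.
  have sX : size (N%:R%:P - 'X : {poly R}) = 2.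
    by rewrite -opprB size_polyN size_XsubC.
  have := size_comp_poly_leq (binom_poly R (m - j)) (N%:R%:P - 'X).
  rewrite sX !size_binom_poly /= muln1 => sc.
  by move: sc; set t := size (_ \Po _) => sc; lia.
move=> y leyN; rewrite hornerD hornerZ -qE //.
under eq_bigr => x _ do
  rewrite hornerD hornerZ horner_binom_poly mulrDr (mulrCA _ d).
rewrite big_split /= -mulr_sumr hahn_kernel_bin // horner_sum.
congr (_ + _ * _); apply: eq_bigr => j _.
rewrite hornerZ hornerM horner_comp hornerD hornerN hornerC hornerX -natrB //.
by rewrite !horner_binom_poly.
Qed.

(** * Hahn polynomials: binomial expansion, orthogonality, exact degree *)

Lemma hahn_poly_binE {R : realFieldType} N n x (a b : R) : 0 < a -> (n <= N)%N ->
  hahn_poly N n x a b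
  = \sum_(k < n.+1) 'C(n, k)%:R * ((-1) ^+ k * poch (n%:R + a + b - 1) k / poch a k)
      / 'C(N, k)%:R * 'C(x, k)%:R.
Proof.
move=> a0 lenN; apply: eq_bigr => -[k /= hk] _; rewrite !poch_opp_nat.
field; rewrite poch_neq0 // signr_eq0 !pnatr_eq0 -!lt0n fact_gt0 bin_gt0 /=.
by lia.
Qed.

(** Both [(b)_(N - y) (b + N - y)_m] and [(b)_m (b + m)_(N - y)] equal [(b)_(N - y + m)]. *)
Lemma hahn_measure_shift {R : realFieldType} N (a b : R) m y :
  0 < a -> 0 < b -> (y <= N)%N ->
  hahn_measure y N a b * poch (b + (N - y)%:R) m
  = poch b m * poch (a + b + m%:R) N / poch (a + b) N * hahn_measure y N a (b + m%:R).
Proof.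
move=> a0 b0 leyN; rewrite /hahn_measure.
have := pochD b m (N - y); rewrite addnC pochD => E.
rewrite [a + (b + _)]addrA.
transitivity ('C(N, y)%:R * poch a y * (poch b (N - y) * poch (b + (N - y)%:R) m)
  / poch (a + b) N); first by ring.
have ab0 := addr_gt0 a0 b0.
by rewrite E; field; rewrite !poch_neq0 // ltr_wpDr.
Qed.

(* Tested against the degree-m polynomial (b + N - y)_m, which shifts the
   parameter b of the measure to b + m, P_n gives a multiple of the
   Chu-Vandermonde value (m + 1 - n)_n, which vanishes for m < n. *)
Lemma hahn_poly_orthogonal {R : realFieldType} N n (a b : R) (p : {poly R}) :
  0 < a -> 0 < b -> (n <= N)%N -> (size p <= n)%N ->
  \sum_(y < N.+1) hahn_measure y N a b * hahn_poly N n y a b * p.[y%:R] = 0.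
Proof.
move=> a0 b0 lenN; pose q m : {poly R} := \prod_(i < m) ('X - (b + N%:R + i%:R)%:P).
move: p; apply: (@poly_graded_ind _ _ q n) => [m _||p m d ltmn IHp].
- rewrite /q -(big_mkord xpredT (fun i => 'X - (b + N%:R + i%:R)%:P)) size_prod_XsubC.
  by rewrite size_iota subn0.
- by rewrite big1 // => y _; rewrite horner0 mulr0.
(* The roots [b + N + i] of [q m] are chosen to produce this rising factorial. *)
have qE y : (y <= N)%N -> (q m).[y%:R] = (-1) ^+ m * poch (b + (N - y)%:R) m.
  move=> leyN; rewrite horner_prod /poch -[m in _ ^+ m]card_ord -prodr_const.
  rewrite -big_split /=; apply: eq_bigr => i _.
  by rewrite hornerXsubC natrB //; ring.
under eq_bigr => y _ do rewrite hornerD hornerZ mulrDr (mulrCA _ d).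
rewrite big_split /= IHp add0r -mulr_sumr.
suff -> : \sum_(y < N.+1) hahn_measure y N a b * hahn_poly N n y a b * (q m).[y%:R] = 0.
  by rewrite mulr0.
have bm0 : 0 < b + m%:R by rewrite ltr_wpDr.
have abm0 : 0 < a + (b + m%:R) by rewrite addr_gt0.
set s := a + (b + m%:R) in abm0.
pose C := (-1) ^+ m * (poch b m * poch (a + b + m%:R) N / poch (a + b) N).
pose g k := 'C(n, k)%:R * ((-1) ^+ k * poch (n%:R + a + b - 1) k / poch a k)
      / 'C(N, k)%:R.
transitivity (\sum_(y < N.+1) \sum_(k < n.+1)
   C * (g k * (hahn_measure y N a (b + m%:R) * 'C(y, k)%:R))).
  apply: eq_bigr => -[y /= hy] _; rewrite qE // hahn_poly_binE //.
  transitivity (C * hahn_measure y N a (b + m%:R) * \sum_(k < n.+1) g k * 'C(y, k)%:R).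
    rewrite /C mulrA -(mulrA _ _ (hahn_measure _ _ _ _)) -hahn_measure_shift //.
    rewrite -/(g _); set P := \sum_(k < _) _; rewrite -[X in _ = _ * X]/P.
    by ring.
  by rewrite mulr_sumr; apply: eq_bigr => k _; ring.
rewrite exchange_big /=.
under eq_bigr => k _ do rewrite -!mulr_sumr hahn_measure_bin_moment // -/s.
rewrite -mulr_sumr.
(* The factors ['C(N, k)] and [poch a k] of the moment cancel the denominators of [g k]. *)
rewrite (_ : \sum_(k < n.+1) _ =
   \sum_(k < n.+1) 'C(n, k)%:R * ((-1) ^+ k * poch (n%:R + a + b - 1) k / poch s k)).
  rewrite chu_vandermonde //.
  have -> : s - (n%:R + a + b - 1) = - (n - m.+1)%:R.
    by rewrite natrB // /s -natr1; ring.
  by rewrite poch_opp_nat_eq0 ?(mul0r, mulr0) //; lia.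
apply: eq_bigr => -[k /= hk] _; rewrite /g; field.
rewrite !poch_neq0 // pnatr_eq0 -lt0n bin_gt0 /=; lia.
Qed.

Lemma hahn_poly_polynomial {R : realFieldType} N n (a b : R) :
  0 < a -> 0 < b -> (n <= N)%N ->
  exists p : {poly R}, [/\ (size p <= n.+1)%N, p`_n != 0 &
    forall x, p.[x%:R] = hahn_poly N n x a b].
Proof.
move=> a0 b0 lenN.
pose g k := 'C(n, k)%:R * ((-1) ^+ k * poch (n%:R + a + b - 1) k / poch a k)
      / 'C(N, k)%:R.
exists (\sum_(k < n.+1) g k *: binom_poly R k); split.
- apply: leq_trans (size_sum _ _ _) _; apply/bigmax_leqP => -[k /= hk] _.
  by apply: leq_trans (size_scale_leq _ _) _; rewrite size_binom_poly.
- rewrite coef_sum big_ord_recr /= big1 ?add0r; last first.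
    by move=> i _; rewrite coefZ nth_default ?mulr0 // size_binom_poly.
  rewrite coefZ mulf_neq0 //; last first.
    have := lead_coef_eq0 (binom_poly R n).
    by rewrite /lead_coef -size_poly_eq0 size_binom_poly /= => ->.
  rewrite /g binn mul1r !mulf_neq0 ?invr_eq0 ?signr_eq0 ?(poch_neq0 a) //.
    (* For [n = 0] the product is empty, since [a + b - 1] may fail to be positive; for [n = m + 1]
       the base point is [a + b + m > 0]. *)
    case: (n) => [|m]; first by rewrite poch0 oner_eq0.
    rewrite poch_neq0 // -natr1 (_ : _ - 1 = a + b + m%:R); last by ring.
    by rewrite ltr_wpDr ?addr_gt0.
  by rewrite pnatr_eq0 -lt0n bin_gt0.
move=> x; rewrite hahn_poly_binE // horner_sum; apply: eq_bigr => k _.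
by rewrite hornerZ horner_binom_poly.
Qed.

Lemma hahn_poly0 {R : realFieldType} N n (a b : R) : hahn_poly N n 0 a b = 1.
Proof.
rewrite /hahn_poly big_ord_recl big1 => [|k _]; last first.
  by rewrite (poch_opp_nat_eq0 0) ?mulr0 ?mul0r.
by rewrite !poch0 !mulr1 mul1r invr1 addr0.
Qed.

(** * Eigenvalue and eigenvector equation *)

(** At [y = 0] only the term [j = 0] of [hahn_kernel_bin] survives, and its ['C(N, k)] cancels the
    one in the binomial expansion of [hahn_poly]. *)
Lemma hahn_kernel_hahn_poly0 {R : realFieldType} N n (a b c : R) :
  0 < a -> 0 < b -> 0 < c -> (n <= N)%N ->
  \sum_(x < N.+1) hahn_kernel N a b c x 0 * hahn_poly N n x (a + b) (b + c)
  = hahn_kappa a b c n.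
Proof.
move=> a0 b0 c0 lenN.
under eq_bigr => x _ do rewrite hahn_poly_binE ?addr_gt0 // mulr_sumr.
rewrite exchange_big /=; apply: eq_bigr => -[k /= hk] _.
under eq_bigr => x _ do rewrite mulrCA.
rewrite -mulr_sumr hahn_kernel_bin // big_ord_recl big1 => [|j _]; last first.
  by rewrite mul0r mulr0.
rewrite /= subn0 bin0 !poch0 subn0.
have -> : n%:R + (a + b) + (b + c) - 1 = n%:R + a + 2 * b + c - 1 by ring.
field; rewrite !poch_neq0 ?addr_gt0 // pnatr_eq0 -lt0n bin_gt0 /=; lia.
Qed.

(** With [q] the image of [P_n], the remainder [D = q - al P_n] has degree below [n] and turns out
    to be orthogonal to both [q] and [P_n], hence to itself. *)
Lemma hahn_kernel_hahn_poly {R : realFieldType} N n (a b c : R) y :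
  0 < a -> 0 < b -> 0 < c -> (n <= N)%N -> (y <= N)%N ->
  \sum_(x < N.+1) hahn_kernel N a b c x y * hahn_poly N n x (a + b) (b + c)
  = hahn_kappa a b c n * hahn_poly N n y (a + b) (b + c).
Proof.
move=> a0 b0 c0 lenN leyN.
have ab0 := addr_gt0 a0 b0; have bc0 := addr_gt0 b0 c0.
pose pi y := hahn_measure y N (a + b) (b + c).
pose P x := hahn_poly N n x (a + b) (b + c).
pose K := hahn_kernel N a b c.
have [p [sp pn pE]] := hahn_poly_polynomial N n _ _ ab0 bc0 lenN.
have [q sq qE] := hahn_kernel_poly N a b c n.+1 p a0 b0 c0 sp.
(* Orthogonality of P_n to lower degrees forces D = 0 on {0, ..., N}. *)
pose al := q`_n / p`_n; pose D := q - al *: p.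
have sD : (size D <= n)%N.
  apply/leq_sizeP => j; rewrite leq_eqVlt coefB coefZ => /orP[/eqP <-|hj].
    by rewrite divfK ?subrr.
  rewrite [q`_j]nth_default ?(leq_trans sq) //.
  by rewrite [p`_j]nth_default ?(leq_trans sp) ?mulr0 ?subr0.
have orth (r : {poly R}) : (size r <= n)%N ->
    \sum_(z < N.+1) pi z * r.[z%:R] * P z = 0.
  move=> sr; rewrite -[RHS](hahn_poly_orthogonal N n _ _ r ab0 bc0 lenN sr).
  by apply: eq_bigr => z _; rewrite mulrAC.
have [r sr rE] := hahn_kernel_poly N a b c n D a0 b0 c0 sD.
(* Detailed balance moves the kernel from [P_n] onto [D]; the image [r] of [D] still has degree
   below [n], hence is orthogonal to [P_n]. *)
have Dq : \sum_(z < N.+1) pi z * D.[z%:R] * q.[z%:R] = 0.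
  rewrite -[RHS](orth r) //.
  transitivity (\sum_(z < N.+1) \sum_(x < N.+1)
      pi z * D.[z%:R] * (K x z * P x)).
    apply: eq_bigr => z _; rewrite -qE ?leq_ord // mulr_sumr.
    by apply: eq_bigr => x _; rewrite pE.
  rewrite exchange_big; apply: eq_bigr => x _ /=.
  rewrite -rE ?leq_ord // [X in _ = X * _]mulr_sumr mulr_suml; apply: eq_bigr => z _.
  have := hahn_kernel_balance N a b c x z a0 b0 c0 (leq_ord x) (leq_ord z).
  rewrite -/K -/(pi z) -/(pi x) => E.
  transitivity (K x z * pi z * D.[z%:R] * P x); first by ring.
  by rewrite E; ring.
have DD : \sum_(z < N.+1) pi z * D.[z%:R] ^+ 2 = 0.
  transitivity (\sum_(z < N.+1) (pi z * D.[z%:R] * q.[z%:R]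
     - al * (pi z * D.[z%:R] * P z))).
    apply: eq_bigr => z _; rewrite /P -pE.
    by rewrite expr2 {2}/D hornerD hornerN hornerZ; ring.
  by rewrite sumrB Dq -mulr_sumr orth // mulr0 subrr.
(* A vanishing sum of squares with positive weights has only zero terms. *)
have D0 z : (z <= N)%N -> D.[z%:R] = 0.
  move=> lezN; apply/eqP; rewrite -sqrf_eq0.
  have pi0 x : (x <= N)%N -> 0 < pi x by move=> hx; apply: hahn_measure_gt0.
  have term_ge0 (i : 'I_N.+1) : true -> 0 <= pi i * D.[i%:R] ^+ 2.
    by rewrite mulr_ge0 ?sqr_ge0 // ltW ?pi0 ?leq_ord.
  have /(_ (Ordinal (lezN : z < N.+1)%N) isT)/eqP /= := psumr_eq0P term_ge0 DD.
  by rewrite mulf_eq0 gt_eqF ?pi0.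
have eig z : (z <= N)%N -> \sum_(x < N.+1) K x z * P x = al * P z.
  move=> lezN; have /eqP := D0 z lezN.
  rewrite hornerD hornerN hornerZ subr_eq0 pE -qE // => /eqP <-.
  by apply: eq_bigr => x _; rewrite pE.
(* Since [P_n] is 1 at 0, this instance identifies [al] with [hahn_kappa]. *)
have := eig 0%N isT.
by rewrite /K /P hahn_kernel_hahn_poly0 // hahn_poly0 mulr1 => ->; apply: eig.
Qed.

Theorem mainTheorem13 (R : realFieldType) (N : nat) (hN : (1 <= N)%N)
    (a b c : R) (ha : 0 < a) (hb : 0 < b) (hc : 0 < c) :
  [/\ forall x y : 'I_N.+1, 0 <= hahn_kernel N a b c x y,
      forall y : 'I_N.+1, \sum_(x < N.+1) hahn_kernel N a b c x y = 1,
      forall x y : 'I_N.+1,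
        hahn_kernel N a b c x y * hahn_measure y N (a + b) (b + c)
        = hahn_kernel N a b c y x * hahn_measure x N (a + b) (b + c)
    & forall x n : 'I_N.+1,
        \sum_(y < N.+1)
          hahn_kernel N a b c x y * hahn_measure y N (a + b) (b + c)
          * hahn_poly N n y (a + b) (b + c)
        = hahn_kappa a b c n * hahn_measure x N (a + b) (b + c)
          * hahn_poly N n x (a + b) (b + c)].
Proof.
split=> [x y|y|x y|x n].
- by rewrite hahn_kernel_ge0 ?leq_ord.
- by rewrite sum_hahn_kernel1 ?leq_ord.
- by rewrite hahn_kernel_balance ?leq_ord.
(* Detailed balance replaces [K(x, y) pi(y)] by [K(y, x) pi(x)], so the sum over [y] becomes the
   eigenvector equation, which sums over the first argument of the kernel. *)
rewrite mulrAC -hahn_kernel_hahn_poly ?leq_ord // mulr_suml.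
by apply: eq_bigr => y _; rewrite hahn_kernel_balance ?leq_ord // mulrAC.
Qed.
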